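(* Let $K\subseteq\mathbb{R}^m$ be a closed, convex, pointed and solid cone, let $f^1,\dots,f^p:\mathbb{R}^n\to\mathbb{R}^m$ be continuously differentiable, let $F(x)=\{f^1(x),\dots,f^p(x)\}$ for $x\in\mathbb{R}^n$, and let $\bar x\in\mathbb{R}^n$, with $\bar\omega=\omega(\bar x)$. Suppose that $\bar x$ is a local weakly minimal solution of the set optimization problem of minimizing $F$ over $\mathbb{R}^n$ with respect to the lower set less relation. Then $$(\ast)\qquad \forall\, a=(a_1,\dots,a_{\bar\omega})\in P_{\bar x},\ \exists\,\mu_1,\dots,\mu_{\bar\omega}\in K^*:\ \sum_{j=1}^{\bar\omega}\nabla f^{a_j}(\bar x)\mu_j=0,\quad (\mu_1,\dots,\mu_{\bar\omega})\neq 0 .$$ Conversely, assume that $f^i$ is $K$-convex for each $i\in I(\bar x)$, that is, $$\forall\, i\in I(\bar x),\ x_1,x_2\in\mathbb{R}^n,\ t\in[0,1]:\quad f^i(tx_1+(1-t)x_2)\preceq t f^i(x_1)+(1-t)f^i(x_2).$$ Then condition $(\ast)$ is also sufficient for $\bar x$ to be a local weakly minimal solution of this set optimization problem.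
   Context: Notation: $[k]=\{1,\dots,k\}$. A cone $K\subseteq\mathbb{R}^m$ is a nonempty set with $ty\in K$ for all $y\in K$, $t\ge 0$; it is convex if $K+K=K$, pointed if $K\cap(-K)=\{0\}$, solid if $\operatorname{int}K\ne\emptyset$. Dual cone: $K^*=\{v\in\mathbb{R}^m\mid v^\top y\ge 0\ \forall y\in K\}$. Order: $y\preceq z$ iff $z-y\in K$. For differentiable $f:\mathbb{R}^n\to\mathbb{R}^m$, $\nabla f(x)\in\mathbb{R}^{n\times m}$ is the transpose of the Jacobian, so $\nabla f(x)^\top u\in\mathbb{R}^m$ is the directional derivative of $f$ at $x$ along $u\in\mathbb{R}^n$. For a nonempty $A\subseteq\mathbb{R}^m$: $\operatorname{Min}(A,K)=\{y\in A\mid (y-K)\cap A=\{y\}\}$. Strict lower set less relation: for nonempty $A,B\subseteq\mathbb{R}^m$, $A\prec^\ell B$ iff $B\subseteq A+\operatorname{int}K$. A point $\bar x$ is a local weakly minimal solution of the set optimization problem ($\preceq^\ell$-minimize $F(x)$ over $x\in\mathbb{R}^n$) if there is a neighborhood $U$ of $\bar x$ such that no $x\in U$ satisfies $F(x)\prec^\ell F(\bar x)$. Index sets: $I(x)=\{i\in[p]\mid f^i(x)\in\operatorname{Min}(F(x),K)\}$; for $v\in\mathbb{R}^m$, $I_v(x)=\{i\in I(x)\mid f^i(x)=v\}$; $\omega(x)=|\operatorname{Min}(F(x),K)|$. For each $x$ an enumeration $v^x_1,\dots,v^x_{\omega(x)}$ of $\operatorname{Min}(F(x),K)$ (as distinct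 vectors) is fixed, and the partition set of $x$ is $P_x=\prod_{j=1}^{\omega(x)}I_{v^x_j}(x)$. *)

(* Defs.v *)
From mathcomp Require Import all_boot all_order all_algebra.
From mathcomp Require Import finmap.
From mathcomp Require Import all_classical all_reals all_analysis.

Set Implicit Arguments.
Unset Strict Implicit.
Unset Printing Implicit Defensive.

Import Order.TTheory GRing.Theory Num.Theory.
Import numFieldNormedType.Exports.

Local Open Scope classical_set_scope.
Local Open Scope ring_scope.

(* Vectors of R^n are row vectors.  With this convention the library's Jacobian
   satisfies ['d f x u = u *m 'J f x], so ['J f x : 'M_(n, m)] is the transpose
   of the usual m x n Jacobian matrix, i.e. the gradient matrix of f at x. *)

Section Cones.
Context {R : realType} {m : nat}.
Implicit Types (A B K : set 'rV[R]_m) (y z v : 'rV[R]_m).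

Definition minkowski_sum A B : set 'rV[R]_m := [set y + z | y in A & z in B].

Definition is_cone K : Prop :=
  K !=set0 /\ forall y (t : R), K y -> 0 <= t -> K (t *: y).

Definition convex_cone K : Prop := is_cone K /\ minkowski_sum K K = K.

Definition pointed K : Prop := K `&` [set - y | y in K] = [set 0].

Definition solid K : Prop := K° !=set0.

Definition dual_cone K : set 'rV[R]_m :=
  [set v | forall y, K y -> 0 <= (v *m y^T) ord0 ord0].

Definition cone_le K y z : Prop := K (z - y).

Definition Min A K : set 'rV[R]_m :=
  [set y | A y /\ [set y - k | k in K] `&` A = [set y]].

Definition strict_lower_less K A B : Prop := B `<=` minkowski_sum A K°.

End Cones.

Section SetOptimization.
Context {R : realType} {n m : nat}.

Definition cont_differentiable (g : 'rV[R]_n -> 'rV[R]_m) : Prop :=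
  (forall x, differentiable g x) /\ continuous (fun x => 'J g x).

Definition K_convex (K : set 'rV[R]_m) (g : 'rV[R]_n -> 'rV[R]_m) : Prop :=
  forall (x1 x2 : 'rV[R]_n) (t : R), 0 <= t <= 1 ->
    cone_le K (g (t *: x1 + (1 - t) *: x2)) (t *: g x1 + (1 - t) *: g x2).

Definition local_weakly_minimal (K : set 'rV[R]_m)
    (F : 'rV[R]_n -> set 'rV[R]_m) (xbar : 'rV[R]_n) : Prop :=
  exists2 U : set 'rV[R]_n, nbhs xbar U &
    ~ exists2 x, U x & strict_lower_less K (F x) (F xbar).

Section FiniteFamily.
Context {p : nat}.
Variables (K : set 'rV[R]_m) (f : 'I_p -> 'rV[R]_n -> 'rV[R]_m).

Definition F_of (x : 'rV[R]_n) : set 'rV[R]_m := [set f i x | i in [set: 'I_p]].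

Definition active (x : 'rV[R]_n) : set 'I_p :=
  [set i | Min (F_of x) K (f i x)].

Definition active_at (x : 'rV[R]_n) (v : 'rV[R]_m) : set 'I_p :=
  [set i | active x i /\ f i x = v].

Definition omega (x : 'rV[R]_n) : nat := #|` fset_set (Min (F_of x) K)|.

(* Min (F_of x) K is finite, being contained in the range of a function on 'I_p,
   so omega is its actual cardinality and enumerations exist. *)
Definition Min_enumeration (v : forall x, 'I_(omega x) -> 'rV[R]_m) : Prop :=
  forall x, set_bij [set: 'I_(omega x)] (Min (F_of x) K) (v x).

Definition partition_set (v : forall x, 'I_(omega x) -> 'rV[R]_m)
    (x : 'rV[R]_n) : set {ffun 'I_(omega x) -> 'I_p} :=
  [set a | forall j, active_at x (v x j) (a j)].

Definition stationary (v : forall x, 'I_(omega x) -> 'rV[R]_m)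
    (xbar : 'rV[R]_n) : Prop :=
  forall a, @partition_set v xbar a ->
    exists mu : {ffun 'I_(omega xbar) -> 'rV[R]_m},
      [/\ forall j, dual_cone K (mu j),
          \sum_j 'J (f (a j)) xbar *m (mu j)^T = 0
        & mu != 0].

End FiniteFamily.

End SetOptimization.

(* Main.v *)
Require Import Defs.
From mathcomp Require Import all_boot all_order all_algebra.
From mathcomp Require Import all_classical all_reals all_analysis.
From mathcomp Require Import ring lra.

Import Order.TTheory GRing.Theory Num.Theory.
Import numFieldNormedType.Exports.

Local Open Scope classical_set_scope.
Local Open Scope ring_scope.

Set Implicit Arguments.
Unset Strict Implicit.
Unset Printing Implicit Defensive.

(* Necessity: if along some direction u all the derivatives of the f^{a_j} at xbar
   lie in - int K, a short step along u strictly improves every minimal value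
   and hence, by domination in the finite set F(xbar), every value.  Otherwise
   the tuples of directional derivatives avoid (- int K)^omega, and a separating
   functional provides the multipliers.

   Sufficiency: near xbar an index i with f^i(x) strictly below v_j satisfies
   f^i(xbar) <= v_j because K is closed and f^i continuous, so f^i(xbar) = v_j by
   minimality.  A strictly better x thus yields an element of the partition set,
   and convexity puts its directional derivatives along x - xbar in - int K;
   pairing them with multipliers in K^* that are not all zero gives a negative
   number instead of 0. *)

(** Matches the pairing in [dual_cone] literally, so dual membership converts to nonnegativity of
    [dot]. *)
Definition dot {R : realType} {N : nat} (u w : 'rV[R]_N) : R :=
  (u *m w^T) ord0 ord0.

(** * Euclidean inner product on row vectors *)

Section Dot.
Context {R : realType} {N : nat}.
Implicit Types u w x : 'rV[R]_N.

Lemma dotE u w : dot u w = \sum_i u ord0 i * w ord0 i.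
Proof. by rewrite /dot mxE; apply: eq_bigr => i _; rewrite mxE. Qed.

Lemma dotC u w : dot u w = dot w u.
Proof. by rewrite !dotE; apply: eq_bigr => i _; rewrite mulrC. Qed.

Lemma dotDr u w x : dot u (w + x) = dot u w + dot u x.
Proof. by rewrite /dot linearD mulmxDr mxE. Qed.

Lemma dotNr u w : dot u (- w) = - dot u w.
Proof. by rewrite /dot linearN mulmxN mxE. Qed.

Lemma dotBr u w x : dot u (w - x) = dot u w - dot u x.
Proof. by rewrite dotDr dotNr. Qed.

Lemma dotZr u (t : R) w : dot u (t *: w) = t * dot u w.
Proof. by rewrite /dot linearZ -scalemxAr mxE. Qed.

Lemma dot_sqrD u w : dot (u + w) (u + w) = dot u u + (2 * dot u w + dot w w).
Proof. by rewrite dotDr ![dot (u + w) _]dotC !dotDr [dot w u]dotC; ring. Qed.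

Lemma dot_sum_sqr u : dot u u = \sum_i u ord0 i ^+ 2.
Proof. by rewrite dotE; apply: eq_bigr => i _; rewrite expr2. Qed.

Lemma dot_ge0 u : 0 <= dot u u.
Proof. by rewrite dot_sum_sqr; apply: sumr_ge0 => i _; exact: sqr_ge0. Qed.

Lemma sqr_coord_le_dot u i : u ord0 i ^+ 2 <= dot u u.
Proof.
rewrite dot_sum_sqr (bigD1 i) //= lerDl.
by apply: sumr_ge0 => j _; exact: sqr_ge0.
Qed.

Lemma dot_gt0 u : u != 0 -> 0 < dot u u.
Proof.
move=> u0; rewrite lt_neqAle dot_ge0 andbT eq_sym.
apply: contra u0 => /eqP uu0; apply/eqP/rowP => i; rewrite mxE.
apply/eqP; rewrite -sqrf_eq0 eq_le sqr_ge0 andbT -uu0.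
exact: sqr_coord_le_dot.
Qed.

Lemma dot_shift_continuous p : continuous (fun x => dot (x - p) (x - p)).
Proof.
rewrite (_ : (fun x => _) =
    fun x => \sum_i (x ord0 i - p ord0 i) * (x ord0 i - p ord0 i)); last first.
  by apply/funext => x; rewrite dotE; apply: eq_bigr => i _; rewrite !mxE.
apply: continuous_big => [|i _ x]; first exact: add_continuous.
have coordB : {for x, continuous (fun y : 'rV[R]_N => y ord0 i - p ord0 i)}.
  by apply: continuousB; [exact: coord_continuous | exact: cst_continuous].
exact: (@continuousM _ _ _ _ x coordB coordB).
Qed.

(** Bounds Euclidean balls in the max norm of ['rV]: each coordinate of [x - p] has square at most
    [c], and [c <= (1 + c) ^+ 2] avoids a square root. *)
Lemma norm_le_of_dot_shift p (c : R) x :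
  dot (x - p) (x - p) <= c -> `|x| <= `|p| + (1 + c).
Proof.
move=> xc; have c0 : 0 <= c := le_trans (dot_ge0 _) xc.
rewrite -[x](subrK p) addrC (le_trans (ler_normD _ _)) // lerD2l.
rewrite [leLHS]/Num.norm /= mx_normrE.
apply: bigmax_le; first by rewrite addr_ge0.
move=> [i j] _ /=; rewrite (ord1 i) -(@ler_pXn2r _ 2) ?nnegrE ?addr_ge0 //.
rewrite real_normK ?num_real // (le_trans (sqr_coord_le_dot _ j)) //.
by apply: (le_trans xc); rewrite expr2; nra.
Qed.

End Dot.

(* A nonzero normal is obtained as [c - p], where [c] is the point of the
   closure of [S] nearest to [p]: moving from [c] along [s] stays in the closure,
   so the distance to [p] cannot decrease. *)
Lemma cone_separation {R : realType} {N : nat} (S : set 'rV[R]_N)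
    (p : 'rV[R]_N) :
  S !=set0 ->
  (forall x s (t : R), S x -> S s -> 0 <= t -> S (x + t *: s)) ->
  ~ closure S p ->
  exists2 mu : 'rV[R]_N, mu != 0 & forall s, S s -> 0 <= dot mu s.
Proof.
move=> [s0 Ss0] Scone Sp.
pose g x := dot (x - p) (x - p).
(* Cutting the closure by a sublevel set of [g] gives a compact set that still contains a nearest
   point. *)
pose A := closure S `&` [set x | g x <= g s0].
have As0 : A s0 by split; [exact: subset_closure | exact: lexx].
have cA : compact A.
  apply: bounded_closed_compact.
    exists (`|p| + (1 + g s0)); split; first exact: num_real.
    by move=> M ltM x [_ /norm_le_of_dot_shift /le_trans]; apply; exact: ltW.
  apply: closedI; first exact: closed_closure.
  apply: (@closed_comp _ _ g [set y | y <= g s0]); last exact: closed_le.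
  by move=> x _; exact: dot_shift_continuous.
have [c cA' cmin] := compact_EVT_min (ex_intro _ s0 As0) cA
  (continuous_subspaceT (@dot_shift_continuous _ _ p)).
have [Sc gc] := set_mem cA'.
have gmin x : closure S x -> g c <= g x.
  move=> Sx; have [xs0|/ltW s0x] := leP (g x) (g s0).
    by apply: cmin; exact: mem_set.
  exact: le_trans gc s0x.
exists (c - p) => [|s Ss].
  by apply/eqP => /subr0_eq cp; apply: Sp; rewrite -cp.
have Scs t : 0 <= t -> closure S (c + t *: s).
  move=> t0 B Bc.
  have cshift : {for c, continuous (fun x : 'rV[R]_N => x + t *: s)}.
    by apply: continuousD; [exact: cvg_id | exact: cst_continuous].
  have [x [Sx Bx]] := Sc _ (cshift _ Bc).
  by exists (x + t *: s); split => //; exact: Scone.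
rewrite leNgt; apply/negP => mus.
pose d := dot s s; have d0 : 0 <= d := dot_ge0 s.
(* For this [t] the squared distance changes by [- t ^+ 2 * (d + 2) < 0]; the [+ 1] keeps the
   denominator positive. *)
pose t := - dot (c - p) s / (d + 1).
have t0 : 0 < t by rewrite divr_gt0 ?oppr_gt0 // ltr_wpDl.
have := gmin _ (Scs _ (ltW t0)).
rewrite /g (_ : c + t *: s - p = (c - p) + t *: s); last by rewrite addrAC.
rewrite dot_sqrD lerDl !dotZr [dot (t *: s) s]dotC dotZr -/d.
have tE : t * (d + 1) = - dot (c - p) s by rewrite divfK // gt_eqF // ltr_wpDl.
nra.
Qed.

(** * Convex cones: interior, dual cone, minimal elements *)

Section ConvexCones.
Context {R : realType} {m : nat}.
Implicit Types (K : set 'rV[R]_m) (y z mu : 'rV[R]_m).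

Lemma convex_cone_add K y z : convex_cone K -> K y -> K z -> K (y + z).
Proof. by move=> [_ KK] Ky Kz; rewrite -KK; exists y => //; exists z. Qed.

Lemma convex_cone_scale K y (t : R) :
  convex_cone K -> 0 <= t -> K y -> K (t *: y).
Proof. by move=> [[_ Kt] _] t0 Ky; exact: Kt. Qed.

Lemma convex_cone0 K : convex_cone K -> K 0.
Proof.
by move=> Kc; have [[[y Ky] _] _] := Kc; rewrite -(scale0r y);
  exact: convex_cone_scale.
Qed.

Lemma interior_add K y z : convex_cone K -> K° y -> K z -> K° (y + z).
Proof.
move=> Kc Ky Kz.
have cB : {for y + z, continuous (fun w : 'rV[R]_m => w - z)}.
  by apply: continuousB; [exact: cvg_id | exact: cst_continuous].
have : nbhs (y + z) ((fun w => w - z) @^-1` K) by apply: cB; rewrite addrK.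
apply: filterS => w /= Kw.
by rewrite -(subrK z w); exact: convex_cone_add.
Qed.

Lemma interior_scale K y (t : R) :
  convex_cone K -> 0 < t -> K° y -> K° (t *: y).
Proof.
move=> Kc t0 Ky.
have cZ : {for t *: y, continuous (fun w : 'rV[R]_m => t^-1 *: w)}.
  exact: scaler_continuous.
have tV : t^-1 *: (t *: y) = y by rewrite scalerA mulVf ?scale1r // gt_eqF.
have : nbhs (t *: y) ((fun w => t^-1 *: w) @^-1` K) by apply: cZ; rewrite tV.
apply: filterS => w /= Kw.
rewrite -[w](_ : t *: (t^-1 *: w) = w); last first.
  by rewrite scalerA mulfV ?scale1r // gt_eqF.
exact: convex_cone_scale (ltW t0) Kw.
Qed.

(** For small [t > 0] the point [y - t *: mu] is still in [K], whence
    [dot mu y >= t * dot mu mu > 0]. *)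
Lemma dual_cone_interior_gt0 K mu y :
  dual_cone K mu -> mu != 0 -> K° y -> 0 < dot mu y.
Proof.
move=> Kmu mu0 Ky.
have cB : {for 0, continuous (fun t : R => y - t *: mu)}.
  apply: continuousB; first exact: cst_continuous.
  exact: scalel_continuous.
have cR : y - t *: mu @[t --> (0 : R)^'+] --> y - 0 *: mu.
  exact: cvg_at_right_filter cB.
have : \forall t \near (0 : R)^'+, K (y - t *: mu).
  by apply: cR; rewrite scale0r subr0.
move=> /(filterI (nbhs_right_gt 0)) /filter_ex[t [t0 /Kmu]].
rewrite -[_ ord0 ord0]/(dot mu (y - t *: mu)) dotBr dotZr subr_ge0.
by apply: lt_le_trans; rewrite mulr_gt0 // dot_gt0.
Qed.

Lemma pointed_antisym K y z : pointed K -> K (y - z) -> K (z - y) -> y = z.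
Proof.
move=> Kp Kyz Kzy; apply/subr0_eq.
suff : (K `&` [set - w | w in K]) (y - z) by rewrite Kp.
by split => //; exists (z - y); rewrite ?opprB.
Qed.

Lemma MinP K (A : set 'rV[R]_m) y : convex_cone K ->
  Min A K y <-> A y /\ forall z, A z -> K (y - z) -> z = y.
Proof.
move=> Kc; split=> [[Ay AK]|[Ay AK]]; split => //.
  move=> z Az Kyz; have : [set y] z by rewrite -AK; split => //; exists (y - z);
    rewrite ?subKr.
  by [].
apply/seteqP; split=> [z [[k Kk <-] Az]|z ->].
  by apply: AK => //; rewrite subKr.
by split => //; exists 0; rewrite ?subr0 //; exact: convex_cone0.
Qed.

(* An index below [f i] with fewest indices below it is minimal. *)
Lemma Min_domination K (n p : nat) (f : 'I_p -> 'rV[R]_n -> 'rV[R]_m) x i :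
  convex_cone K -> pointed K ->
  exists2 l, active K f x l & K (f i x - f l x).
Proof.
move=> Kc Kp; have K0 := convex_cone0 Kc.
pose below l := [set k | `[< K (f l x - f k x) >]]%SET.
pose dominating l := `[< K (f i x - f l x) >].
have Kii : dominating i by apply/asboolP; rewrite subrr.
case: (@arg_minnP _ i dominating (fun l => #|below l|) Kii) =>
  l /asboolP Kil lmin.
exists l => //; apply/MinP => //; split; first by exists l.
move=> _ [k _ <-] Klk.
have Kik : K (f i x - f k x).
  by rewrite -(subrKA (f l x)); exact: convex_cone_add.
(* Transitivity gives the inclusion; the minimal count at [l] makes it an equality, so [l] is below
   [k] as well. *)
have skl : below k \subset below l.
  apply/fintype.subsetP => h; rewrite !finset.inE => /asboolW Kkh.
  by apply/asboolT; rewrite -(subrKA (f k x)); exact: convex_cone_add.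
have /eqP bkl : below k == below l.
  by rewrite finset.eqEcard skl /=; have := lmin k; apply; apply/asboolP.
have : l \in below k by rewrite bkl inE; apply/asboolP; rewrite subrr.
by rewrite inE => /asboolP Kkl; exact: pointed_antisym Kp Kkl Klk.
Qed.

End ConvexCones.

(** * One-sided derivatives and the gradient inequality *)

Lemma cvg_difference_quotient {R : realType} {n m : nat}
    (g : 'rV[R]_n -> 'rV[R]_m) x u : differentiable g x ->
  h^-1 *: (g (h *: u + x) - g x) @[h --> (0 : R)^'+] --> u *m 'J g x.
Proof.
move=> gx; rewrite -deriveEjacobian //; apply: cvg_dnbhs_at_right.
exact: diff_derivable.
Qed.

(** Convexity on the segment, divided by [h] in (0, 1], puts [g y - g x - q h] in [K]; closedness
    keeps the limit there. *)
Lemma K_convex_jacobian_le {R : realType} {n m : nat} (K : set 'rV[R]_m)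
    (g : 'rV[R]_n -> 'rV[R]_m) (x y : 'rV[R]_n) :
  closed K -> convex_cone K -> K_convex K g -> differentiable g x ->
  K (g y - g x - (y - x) *m 'J g x).
Proof.
move=> Kcl Kc gK gx.
pose q (h : R) := h^-1 *: (g (h *: (y - x) + x) - g x).
have cq : g y - g x - q h @[h --> (0 : R)^'+] --> g y - g x - (y - x) *m 'J g x.
  by apply: cvgB; [exact: cvg_cst | exact: cvg_difference_quotient].
apply: (closed_cvg K Kcl _ _ cq); near=> h.
have h0 : 0 < h by near: h; exact: nbhs_right_gt.
have h1 : h <= 1 by near: h; apply: nbhs_right_le; exact: ltr01.
have := gK y x h; rewrite /cone_le ltW // h1 => /(_ isT).
move=> /(convex_cone_scale Kc (ltW _ : 0 <= h^-1)); rewrite invr_gt0 => /(_ h0).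
congr K; rewrite /q.
have -> : h *: (y - x) + x = h *: y + (1 - h) *: x.
  by rewrite scalerBr scalerBl scale1r -addrA [- _ + x]addrC.
have -> : h *: g y + (1 - h) *: g x = h *: (g y - g x) + g x.
  by rewrite scalerBr scalerBl scale1r -addrA [- _ + g x]addrC.
rewrite -addrA scalerDr scalerA mulVf ?gt_eqF // scale1r; congr (_ + _).
by rewrite -scalerN opprB.
Unshelve. all: by end_near. Qed.

(** Tuples of [w] vectors are flattened by [mxvec] so that separation applies in one space; the
    inner product splits over the blocks. *)
Lemma dot_mxvec {R : realType} {w m : nat} (x y : 'rV[R]_(w * m)) :
  dot x y = \sum_j dot (row j (vec_mx x)) (row j (vec_mx y)).
Proof.
rewrite dotE (reindex _ (curry_mxvec_bij w m)) /=.
pose F i j := x ord0 (mxvec_index i j) * y ord0 (mxvec_index i j).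
rewrite (eq_bigr (fun q => F q.1 q.2)) => [|[i j] _ //].
rewrite -(pair_bigA _ F) /=.
apply: eq_bigr => i _; rewrite dotE; apply: eq_bigr => j _.
by rewrite !mxE.
Qed.

Lemma mul_sum_gradient {R : realType} {w n m : nat} (J : 'I_w -> 'M[R]_(n, m))
    (mu : 'I_w -> 'rV[R]_m) (u : 'rV[R]_n) :
  (u *m \sum_j J j *m (mu j)^T) ord0 ord0 = \sum_j dot (mu j) (u *m J j).
Proof.
rewrite mulmx_sumr summxE; apply: eq_bigr => j _.
by rewrite mulmxA dotC.
Qed.

(* Separates [-(e, ..., e)], with [e] interior to [K], from the cone of tuples
   [(u *m J j + k_j)_j] with [k_j] in [K]: a tuple of that cone close to it would
   put every [- (u *m J j)] in the interior. *)
Lemma cone_alternative {R : realType} {w n m : nat} (K : set 'rV[R]_m)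
    (J : 'I_w -> 'M[R]_(n, m)) :
  convex_cone K -> solid K ->
  ~ (exists u : 'rV[R]_n, forall j, K° (- (u *m J j))) ->
  exists mu : {ffun 'I_w -> 'rV[R]_m},
    [/\ forall j, dual_cone K (mu j), \sum_j J j *m (mu j)^T = 0 & mu != 0].
Proof.
move=> Kc [e Ke] Jno; have K0 := convex_cone0 Kc.
pose S := [set s : 'rV[R]_(w * m) |
  exists u : 'rV[R]_n, forall j, K (row j (vec_mx s) - u *m J j)].
have Sblock u (M : 'M[R]_(w, m)) :
    (forall j, K (row j M - u *m J j)) -> S (mxvec M).
  by move=> KM; exists u => j; rewrite mxvecK.
pose p : 'rV[R]_(w * m) := - mxvec (\matrix_(j < w) e).
have [||Sp|mu0 mu0_neq0 mu0S] := @cone_separation _ _ S p.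
- by exists (mxvec 0); apply: (Sblock 0) => j; rewrite mul0mx row0 subr0.
- move=> x s t [u Ku] [u' Ku'] t0; exists (u + t *: u') => j.
  rewrite !linearD !linearZ /= mulmxDl -scalemxAl opprD addrACA -scalerBr.
  by apply: convex_cone_add => //; exact: convex_cone_scale.
- apply: Jno.
  have /nbhs_ballP[eps /= eps0 Keps] : nbhs e K°.
    by apply: open_nbhs_nbhs; split; [exact: open_interior | exact: Ke].
  have [s [[u Ku] ps]] := Sp _ (near_ball p eps eps0).
  (* Block [j] of [- s] is within [eps] of [e], hence interior; the remaining summand lies in [K] by
     the choice of [u]. *)
  exists u => j; rewrite -[- _](addKr (row j (vec_mx s))).
  apply: interior_add => //; apply: Keps; split=> // i k.
  have [_ /(_ ord0 (mxvec_index j k))] := ps.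
  rewrite /ball /= !mxE (ord1 i) mxvecE !mxE.
  by rewrite opprK -opprD normrN.
exists [ffun j => row j (vec_mx mu0)]; split.
- move=> j y Ky; rewrite ffunE.
  (* Testing [mu0] on [y] placed in block [j] alone isolates the [j]-th multiplier. *)
  have : S (mxvec (\matrix_(i < w) if i == j then y else 0)).
    apply: (Sblock 0) => i; rewrite mul0mx subr0 rowK.
    by case: ifP.
  move=> /mu0S; rewrite dot_mxvec (bigD1 j) //= big1 => [|i ij].
    by rewrite mxvecK rowK eqxx addr0.
  by rewrite mxvecK rowK (negbTE ij) /dot trmx0 mulmx0 mxE.
- set W := \sum_j _.
  have W_ge0 (u : 'rV[R]_n) : 0 <= (u *m W) ord0 ord0.
    rewrite mul_sum_gradient.
    have /mu0S : S (mxvec (\matrix_(j < w) (u *m J j))).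
      by apply: (Sblock u) => j; rewrite rowK subrr.
    rewrite dot_mxvec; congr (_ <= _); apply: eq_bigr => j _.
    by rewrite mxvecK rowK ffunE.
  (* A linear form nonnegative everywhere vanishes: at [- W^T] its value is minus the squared length
     of [W]. *)
  have := W_ge0 (- W^T); rewrite mulNmx mxE oppr_ge0 -{2}[W]trmxK.
  apply: contraTeq => W0; rewrite -ltNge; apply: dot_gt0.
  by rewrite -(inj_eq trmx_inj) trmxK trmx0.
- apply: contra mu0_neq0 => /eqP mu_eq0.
  rewrite -[mu0]vec_mxK; apply/eqP.
  rewrite (_ : vec_mx mu0 = 0) ?linear0 //; apply/row_matrixP => j.
  by rewrite row0; move/ffunP: mu_eq0 => /(_ j); rewrite !ffunE.
Qed.

(** * Necessity and sufficiency of stationarity *)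

Section FirstOrderConditions.
Context {R : realType} {n m p : nat} {K : set 'rV[R]_m}.
Context {f : 'I_p -> 'rV[R]_n -> 'rV[R]_m}.
Context {v : forall x : 'rV[R]_n, 'I_(omega K f x) -> 'rV[R]_m}.

Lemma active_enumerated x l :
  Min_enumeration v -> active K f x l -> exists j, @v x j = f l x.
Proof. by move=> /(_ x)[_ _ vsurj] /vsurj[j _ vj]; exists j. Qed.

Lemma local_weakly_minimal_stationary x :
  convex_cone K -> pointed K -> solid K ->
  (forall i, differentiable (f i) x) -> Min_enumeration v ->
  local_weakly_minimal K (F_of f) x -> stationary v x.
Proof.
move=> Kc Kp Ks df v_enum [U Ux Umin] a aP.
apply: cone_alternative => // -[u Ku]; apply: Umin.
have Kquot : \forall h \near (0 : R)^'+, forall j,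
    K° (- (h^-1 *: (f (a j) (h *: u + x) - f (a j) x))).
  apply: filter_forall => j.
  have cq : - (h^-1 *: (f (a j) (h *: u + x) - f (a j) x)) @[h --> (0 : R)^'+]
      --> - (u *m 'J (f (a j)) x).
    by apply: cvgN; exact: cvg_difference_quotient.
  have Knb : nbhs (- (u *m 'J (f (a j)) x)) K°.
    by apply: open_nbhs_nbhs; split; [exact: open_interior | exact: Ku].
  exact: cq _ Knb.
have Uh : \forall h \near (0 : R)^'+, U (h *: u + x).
  have ch : {for 0, continuous (fun h : R => h *: u + x)}.
    by apply: continuousD; [exact: scalel_continuous | exact: cst_continuous].
  have cR : h *: u + x @[h --> (0 : R)^'+] --> 0 *: u + x.
    exact: cvg_at_right_filter ch.
  by apply: cR; rewrite scale0r add0r.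
have [h [h0 [Uhx Kh]]] :=
  filter_ex (filterI (nbhs_right_gt 0) (filterI Uh Kquot)).
exists (h *: u + x) => // _ [i _ <-].
have [l lact Kil] := Min_domination f x i Kc Kp.
have [j vj] := active_enumerated v_enum lact.
have [_ fa] := aP j.
exists (f (a j) (h *: u + x)); first by exists (a j).
(* Since [f (a j) x = f l x], adding this to the new value gives [f i x]; the first difference is
   interior by descent, the second is in [K] by domination. *)
exists (f (a j) x - f (a j) (h *: u + x) + (f i x - f l x)).
  apply: interior_add => //.
  have := interior_scale Kc h0 (Kh j).
  by rewrite scalerN scalerA mulfV ?gt_eqF // scale1r opprB.
by rewrite fa vj addrA !subrKC.
Qed.

Lemma stationary_local_weakly_minimal x :
  closed K -> convex_cone K ->
  (forall i, differentiable (f i) x) -> Min_enumeration v ->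
  (forall i, active K f x i -> K_convex K (f i)) ->
  stationary v x -> local_weakly_minimal K (F_of f) x.
Proof.
move=> Kcl Kc df v_enum fK stat.
have [vMin _ _] := v_enum x.
have Ux : \forall y \near x, forall i j,
    ~ K (@v x j - f i x) -> ~ K (@v x j - f i y).
  apply: (@filter_forall _ _ _ (nbhs x) _) => i.
  apply: (@filter_forall _ _ _ (nbhs x) _) => j.
  have [Kij|Kij] := pselect (K (@v x j - f i x)).
    by apply: nearW => y /(_ Kij).
  have cf : {for x, continuous (fun y => @v x j - f i y)}.
    apply: continuousB; first exact: cst_continuous.
    exact: differentiable_continuous.
  have Knb : nbhs (@v x j - f i x) (~` K).
    by apply: open_nbhs_nbhs; split => //; exact: closed_openC.
  by near=> y; move=> _; near: y; exact: cf _ Knb.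
exists [set y | forall i j, ~ K (@v x j - f i x) -> ~ K (@v x j - f i y)].
  exact: Ux.
move=> [y Uy FyFx].
(* The indices realizing the improvement at [y] form the candidate element of the partition set. *)
have /choice[a0 Ka0] j : exists i, K° (@v x j - f i y).
  have [Fv _] : Min (F_of f x) K (@v x j) by exact: vMin.
  have [_ [i _ <-] [k Kk <-]] := FyFx _ Fv.
  by exists i; rewrite addrAC subrr add0r.
pose a := [ffun j => a0 j].
have Ka j : K° (@v x j - f (a j) y) by rewrite ffunE.
have fa j : f (a j) x = @v x j.
  have /(MinP _ _ Kc)[_ vmin] : Min (F_of f x) K (@v x j) by exact: vMin.
  apply: vmin; first by exists (a j).
  by apply: contrapT => /Uy; apply; exact: interior_subset.
have aact j : active K f x (a j) by rewrite /active /= fa; exact: vMin.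
have [j|mu [Kmu Jmu mu0]] := stat a.
  by split; [exact: aact | exact: fa].
pose u := y - x.
(* Adds the interior vector [f (a j) x - f (a j) y] to the gradient inequality, cancelling both
   values. *)
have Ku j : K° (- (u *m 'J (f (a j)) x)).
  have := interior_add Kc (Ka j)
    (K_convex_jacobian_le y Kcl Kc (fK _ (aact j)) (df _)).
  by rewrite -fa addrA subrKA subrr add0r.
have : \sum_j dot (mu j) (- (u *m 'J (f (a j)) x)) = 0.
  under eq_bigr do rewrite dotNr; rewrite sumrN -mul_sum_gradient.
  by rewrite Jmu mulmx0 mxE oppr0.
(* A vanishing sum of nonnegative terms has only zero terms, whereas a nonzero [mu j] would make its
   term positive. *)
move=> /psumr_eq0P sum0; move/eqP: mu0; apply; apply/ffunP => j.
rewrite ffunE; apply/eqP; apply: contraT => muj0.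
have := dual_cone_interior_gt0 (Kmu j) muj0 (Ku j).
by rewrite sum0 ?ltxx // => k _; apply: Kmu; exact: interior_subset (Ku k).
Unshelve. all: by end_near. Qed.

End FirstOrderConditions.

Theorem theorem3p5 (R : realType) (n m p : nat) (p_gt0 : (0 < p)%N)
    (K : set 'rV[R]_m)
    (K_closed : closed K) (K_convex_cone : convex_cone K)
    (K_pointed : pointed K) (K_solid : solid K)
    (f : 'I_p -> 'rV[R]_n -> 'rV[R]_m)
    (f_C1 : forall i, cont_differentiable (f i))
    (v : forall x : 'rV[R]_n, 'I_(omega K f x) -> 'rV[R]_m)
    (v_enum : Min_enumeration v)
    (xbar : 'rV[R]_n) :
  (local_weakly_minimal K (F_of f) xbar -> stationary v xbar) /\
  ((forall i, active K f xbar i -> K_convex K (f i)) ->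
   stationary v xbar -> local_weakly_minimal K (F_of f) xbar).
Proof.
have df i x : differentiable (f i) x by have [+ _] := f_C1 i; apply.
split; first exact: local_weakly_minimal_stationary.
exact: stationary_local_weakly_minimal.
Qed.
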